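(* Let $k\ge 2$ be an integer. Consider connected edge-weighted graphs $G=(V,\mathbf{W})$ on $n>k$ vertices, with generalized degrees $d_1,\dots,d_n$, degree matrix $\mathbf{D}=\mathrm{diag}(d_1,\dots,d_n)$ and $\mathrm{Vol}(V)=1$. Assume there are no dominant vertices, i.e. $d_i=\Theta(1/n)$ for $i=1,\dots,n$, as $n\to\infty$. Let the eigenvalues of the normalized modularity matrix $\mathbf{M}_D$ of $G$, enumerated in decreasing order of absolute value, satisfy $$1\ge|\mu_1|\ge\dots\ge|\mu_{k-1}|>\varepsilon\ge|\mu_k|\ge\dots\ge|\mu_n|=0 .$$ Let $\mathbf{u}_1,\dots,\mathbf{u}_{k-1}$ be unit-norm, pairwise orthogonal eigenvectors of $\mathbf{M}_D$ corresponding to $\mu_1,\dots,\mu_{k-1}$, and let $\mathbf{X}^*$ be the $n\times(k-1)$ matrix with columns $\mathbf{D}^{-1/2}\mathbf{u}_i$ $(i=1,\dots,k-1)$. Let $(V_1,\dots,V_k)$ be a $k$-partition of $V$ that attains the minimum in the definition of the weighted $k$-variance $S_k^2(\mathbf{X}^* )$, and assume there is a constant $0<K\le\frac1k$ such that $|V_i|\ge Kn$ for $i=1,\dots,k$. Put $s=\sqrt{S_k^2(\mathbf{X}^* )}$. Then the pairs $(V_i,V_j)$, $i\ne j$, are $\mathcal{O}(\sqrt{2k}\,s+\varepsilon)$-volume regular, and for every cluster $V_i$ $(i=1,\dots,k)$ the following holds: for all $X,Y\subset V_i$, $$|w(X,Y)-\rho(V_i)\,\mathrm{Vol}(X)\,\mathrm{Vol}(Y)|=\mathcal{O}(\sqrt{2k}\,s+\varepsilon)\,\mathrm{Vol}(V_i),$$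 where $\rho(V_i)=\frac{w(V_i,V_i)}{\mathrm{Vol}^2(V_i)}$ is the relative intra-cluster density of $V_i$. Here the constants implied in the $\mathcal{O}$'s do not depend on $n$: they depend only on $K$ and on the constants in the condition $d_i=\Theta(1/n)$.
   Context: An edge-weighted graph $G=(V,\mathbf{W})$ on vertex set $V=\{1,\dots,n\}$ is given by an $n\times n$ symmetric matrix $\mathbf{W}=(w_{ij})$ with non-negative real entries and zero diagonal; $G$ is connected if $\mathbf{W}$ is irreducible. The generalized degrees are $d_i=\sum_{j=1}^n w_{ij}$. For $U\subseteq V$, $\mathrm{Vol}(U)=\sum_{i\in U}d_i$; for $X,Y\subseteq V$, the weighted cut is $w(X,Y)=\sum_{i\in X}\sum_{j\in Y}w_{ij}$. When $\mathrm{Vol}(V)=1$, the normalized modularity matrix is $\mathbf{M}_D=\mathbf{D}^{-1/2}\mathbf{W}\mathbf{D}^{-1/2}-\sqrt{\mathbf{d}}\sqrt{\mathbf{d}}^{\,T}$ with $\sqrt{\mathbf{d}}=(\sqrt{d_1},\dots,\sqrt{d_n})^T$; its spectrum lies in $[-1,1]$ and $0$ is always an eigenvalue with unit-norm eigenvector $\sqrt{\mathbf{d}}$. For an $n\times(k-1)$ matrix $\mathbf{X}$ with rows $\mathbf{r}_1,\dots,\mathbf{r}_n\in\mathbb{R}^{k-1}$, the weighted $k$-variance is $$S_k^2(\mathbf{X})=\min_{(V_1,\dots,V_k)}\sum_{a=1}^k\sum_{j\in V_a}d_j\|\mathbf{r}_j-\mathbf{c}_a\|^2,\qquad \mathbf{c}_a=\frac{1}{\mathrm{Vol}(V_a)}\sum_{j\in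 V_a}d_j\mathbf{r}_j,$$ the minimum being over all partitions of $V$ into $k$ non-empty parts. A disjoint pair $A,B\subseteq V$ (with $\mathrm{Vol}(V)=1$) is $\alpha$-volume regular if for all $X\subseteq A$, $Y\subseteq B$ one has $|w(X,Y)-\rho(A,B)\mathrm{Vol}(X)\mathrm{Vol}(Y)|\le\alpha\sqrt{\mathrm{Vol}(A)\mathrm{Vol}(B)}$, where $\rho(A,B)=\frac{w(A,B)}{\mathrm{Vol}(A)\mathrm{Vol}(B)}$. *)

(* Defs.v *)
From HB Require Import structures.
From mathcomp Require Import all_boot all_order all_fingroup all_algebra.
From mathcomp Require Import reals.

Set Implicit Arguments.
Unset Strict Implicit.
Unset Printing Implicit Defensive.
Import Order.TTheory GRing.Theory Num.Theory.
Local Open Scope ring_scope.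

(* The vertex set is 'I_n. *)
Definition weighted_graph (R : realType) (n : nat) (W : 'M[R]_n) : Prop :=
  [/\ W^T = W, forall i j, 0 <= W i j & forall i, W i i = 0].

(* Reducible: some simultaneous permutation of rows and columns produces a
   block-triangular matrix, the block of the last n - r rows and first r
   columns being zero. *)
Definition reducible_mx (R : realType) (n : nat) (A : 'M[R]_n) : Prop :=
  exists (s : 'S_n) (r : nat), (0 < r < n)%N /\
    forall i j : 'I_n, (r <= i)%N -> (j < r)%N ->
      row_perm s (col_perm s A) i j = 0.

Definition connected_graph (R : realType) (n : nat) (W : 'M[R]_n) : Prop :=
  ~ reducible_mx W.

Definition deg (R : realType) (n : nat) (W : 'M[R]_n) (i : 'I_n) : R :=
  \sum_j W i j.

Definition Vol (R : realType) (n : nat) (W : 'M[R]_n) (U : {set 'I_n}) : R :=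
  \sum_(i in U) deg W i.

Definition wcut (R : realType) (n : nat) (W : 'M[R]_n) (X Y : {set 'I_n}) : R :=
  \sum_(i in X) \sum_(j in Y) W i j.

Definition rho (R : realType) (n : nat) (W : 'M[R]_n) (A B : {set 'I_n}) : R :=
  wcut W A B / (Vol W A * Vol W B).

Definition sqrt_deg (R : realType) (n : nat) (W : 'M[R]_n) : 'cV[R]_n :=
  \col_i Num.sqrt (deg W i).

(* D^(-1/2), for positive degrees. *)
Definition Dinvsqrt (R : realType) (n : nat) (W : 'M[R]_n) : 'M[R]_n :=
  diag_mx (\row_i (Num.sqrt (deg W i))^-1).

(* Normalized modularity matrix of a graph with Vol(V) = 1. *)
Definition modularity_mx (R : realType) (n : nat) (W : 'M[R]_n) : 'M[R]_n :=
  Dinvsqrt W *m W *m Dinvsqrt W - sqrt_deg W *m (sqrt_deg W)^T.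

(* Squared Euclidean norm; the library norm on matrices is the sup norm. *)
Definition sqnorm (R : realType) (m : nat) (r : 'rV[R]_m) : R :=
  \sum_l r 0 l ^+ 2.

Definition kpartition (n k : nat) (V : 'I_k -> {set 'I_n}) : Prop :=
  [/\ forall a, V a != set0,
      forall a b, a != b -> [disjoint V a & V b]
    & forall i, exists a, i \in V a].

Definition center (R : realType) (n p : nat) (W : 'M[R]_n) (X : 'M[R]_(n, p))
    (U : {set 'I_n}) : 'rV[R]_p :=
  (Vol W U)^-1 *: \sum_(j in U) deg W j *: row j X.

Definition kcost (R : realType) (n p k : nat) (W : 'M[R]_n)
    (X : 'M[R]_(n, p)) (V : 'I_k -> {set 'I_n}) : R :=
  \sum_(a < k) \sum_(j in V a) deg W j * sqnorm (row j X - center W X (V a)).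

(* There are finitely many k-partitions, and at least one if 0 < k <= n, so
   that this infimum is then a minimum. *)
Definition kvariance (R : realType) (n p k : nat) (W : 'M[R]_n)
    (X : 'M[R]_(n, p)) : R :=
  inf (fun x : R => exists2 V : 'I_k -> {set 'I_n},
                      kpartition V & x = kcost W X V).

Definition min_kpartition (R : realType) (n p k : nat) (W : 'M[R]_n)
    (X : 'M[R]_(n, p)) (V : 'I_k -> {set 'I_n}) : Prop :=
  kpartition V /\ kcost W X V = kvariance k W X.

Definition volume_regular (R : realType) (n : nat) (W : 'M[R]_n) (alpha : R)
    (A B : {set 'I_n}) : Prop :=
  [disjoint A & B] /\
  forall X Y : {set 'I_n}, X \subset A -> Y \subset B ->
    `|wcut W X Y - rho W A B * Vol W X * Vol W Y|
      <= alpha * Num.sqrt (Vol W A * Vol W B).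

(* All eigenvalues with algebraic multiplicity (which for a symmetric matrix is
   the geometric one), in decreasing order of absolute value. *)
Definition abs_sorted_spectrum (R : realType) (n : nat) (M : 'M[R]_n)
    (mu : n.-tuple R) : Prop :=
  char_poly M = \prod_(x <- mu) ('X - x%:P) /\
  sorted (fun x y : R => `|y| <= `|x|) mu.

Definition orthonormal_eigenvectors (R : realType) (n m : nat) (M : 'M[R]_n)
    (mu : n.-tuple R) (u : 'I_m -> 'cV[R]_n) : Prop :=
  (forall i, M *m u i = mu`_i *: u i) /\
  (forall i j, (u i)^T *m u j = (i == j)%:R%:M).

(* The matrix with columns D^(-1/2) u_i. *)
Definition representatives (R : realType) (n m : nat) (W : 'M[R]_n)
    (u : 'I_m -> 'cV[R]_n) : 'M[R]_(n, m) :=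
  \matrix_(j, i) (Dinvsqrt W *m u i) j 0.

(* Main.v *)
Require Import Defs.
From HB Require Import structures.
From mathcomp Require Import all_boot all_order all_fingroup all_algebra.
From mathcomp Require Import reals.
From mathcomp Require Import complex spectral ring lra.

(* Deflating M_D by its leading eigenpairs leaves a symmetric matrix E whose
   quadratic form is bounded by eps, so that with h_X = D^(1/2) 1_X
     w(X,Y) = Vol X Vol Y + \sum_(i < k-1) mu_i f_i(X) f_i(Y) + h_X^T E h_Y,
   where f(X) = \sum_(j in X) d_j r_j.  For X inside a cluster A with center c,
   f(X) = Vol(X) c + delta(X), where delta(A) = 0 and, by Cauchy-Schwarz,
   |delta(X)|^2 <= Vol(A) s^2, while Vol(A) |c|^2 <= k and s^2 <= k.  The terms
   Vol(X) Vol(Y) (1 + \sum_i mu_i c_i c'_i) cancel in the discrepancy; what is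
   left are three cross terms, each at most sqrt k s sqrt(Vol(A) Vol(B)), and two
   error terms, each at most eps sqrt(Vol(A) Vol(B)).  So the absolute constant
   3 works.
   The bound on E avoids choosing an eigenbasis of E: tr E^(2p) is the sum of
   mu_i^(2p) over the remaining eigenvalues, at most n eps^(2p), and letting p
   grow gives |E v| <= eps |v|. *)

Set Implicit Arguments.
Unset Strict Implicit.
Unset Printing Implicit Defensive.
Import Order.TTheory GRing.Theory Num.Theory.
Local Open Scope ring_scope.

(** * Two elementary inequalities *)

Lemma cauchy_schwarz (R : realFieldType) (I : finType) (P : pred I)
    (a b : I -> R) :
  (\sum_(i | P i) a i * b i) ^+ 2 <=
    (\sum_(i | P i) a i ^+ 2) * (\sum_(i | P i) b i ^+ 2).
Proof.
set A := \sum_(i | P i) a i ^+ 2; set B := \sum_(i | P i) b i ^+ 2.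
set C := \sum_(i | P i) a i * b i.
have [A0|A_neq0] := eqVneq A 0.
  have a0 i : P i -> a i = 0.
    move=> Pi; apply/eqP; rewrite -sqrf_eq0.
    by move/psumr_eq0P: A0 => -> // j _; exact: sqr_ge0.
  by rewrite /C big1 ?expr0n ?A0 ?mul0r// => i Pi; rewrite a0 ?mul0r.
have A_gt0 : 0 < A by rewrite lt0r A_neq0 sumr_ge0// => i _; exact: sqr_ge0.
(* This sum expands to [A * (A * B - C ^+ 2)], and [A] is positive here. *)
have : 0 <= \sum_(i | P i) (A * b i - C * a i) ^+ 2.
  by apply: sumr_ge0 => i _; exact: sqr_ge0.
rewrite (eq_bigr (fun i => A ^+ 2 * b i ^+ 2 - 2 * A * C * (a i * b i)
    + C ^+ 2 * a i ^+ 2)); last by move=> i _; ring.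
rewrite !big_split /= sumrN -!mulr_sumr -/A -/B -/C.
have -> : A ^+ 2 * B - 2 * A * C * C + C ^+ 2 * A = A * (A * B - C ^+ 2) by ring.
by rewrite pmulr_rge0// subr_ge0.
Qed.

(** If [y < x], the powers of [x / y] grow without bound by Bernoulli's inequality, so no constant
    [c] can dominate them in an Archimedean field. *)
Lemma le_of_le_expr2 (R : archiRealFieldType) (c x y : R) : 0 <= x -> 0 <= y ->
  (forall p, x ^+ (2 ^ p) <= c * y ^+ (2 ^ p)) -> x <= y.
Proof.
move=> x0 y0 H; rewrite leNgt; apply/negP => yx.
have x_gt0 : 0 < x by exact: le_lt_trans yx.
have [y_eq0|y_neq0] := eqVneq y 0.
  have := H 0%N; rewrite y_eq0 expn0 !expr1 mulr0.
  by rewrite leNgt x_gt0.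
have y_gt0 : 0 < y by rewrite lt0r y_neq0.
set t := x / y - 1.
have t_gt0 : 0 < t by rewrite subr_gt0 ltr_pdivlMr// mul1r.
have bern m : 1 + m%:R * t <= (1 + t) ^+ m.
  elim: m => [|m IH]; first by rewrite mul0r addr0 expr0.
  rewrite exprS; apply: (@le_trans _ _ ((1 + t) * (1 + m%:R * t))).
    rewrite -natr1; have : 0 <= m%:R * t * t :> R by rewrite !mulr_ge0 // ltW.
    by lra.
  by rewrite ler_pM2l// addr_gt0.
(* Only exponents [2 ^ m] are at hand; [m <= 2 ^ m] turns them into a linear bound in every [m]. *)
have Hc m : 1 + m%:R * t <= c.
  apply: (@le_trans _ _ (1 + (2 ^ m)%:R * t)).
    by rewrite lerD2l ler_pM2r// ler_nat ltnW// ltn_expl.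
  apply: (le_trans (bern _)).
  have -> : 1 + t = x / y by rewrite /t; ring.
  by rewrite expr_div_n ler_pdivrMr ?exprn_gt0// H.
have := archi_boundP (x := `|c / t|) (normr_ge0 _).
set m := Num.bound _ => Hm.
have := Hc m; apply/negP; rewrite -ltNge.
have : c < m%:R * t by rewrite -ltr_pdivrMr// (le_lt_trans (ler_norm _)).
by lra.
Qed.

(** * Traces of powers of a symmetric matrix *)

Lemma char_poly_similar (F : fieldType) n (P A : 'M[F]_n) : P \in unitmx ->
  char_poly (invmx P *m A *m P) = char_poly A.
Proof.
move=> Pu; rewrite /char_poly.
have -> : char_poly_mx (invmx P *m A *m P) =
    map_mx polyC (invmx P) *m char_poly_mx A *m map_mx polyC P.
  rewrite /char_poly_mx !map_mxM mulmxBr mulmxBl; congr (_ - _).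
  by rewrite scalar_mxC -mulmxA -map_mxM mulVmx// map_mx1 mulmx1.
rewrite !det_mulmx mulrC mulrA -det_mulmx -map_mxM mulmxV// map_mx1 det1.
by rewrite mul1r.
Qed.

Lemma expmx_similar (F : fieldType) n (P A : 'M[F]_n) p : P \in unitmx ->
  (invmx P *m A *m P) ^+ p = invmx P *m A ^+ p *m P.
Proof.
move=> Pu; elim: p => [|p IH]; first by rewrite !expr0 mulmx1 mulVmx.
by rewrite !exprS IH -!mulmxE !mulmxA mulmxK.
Qed.

Lemma expmx_diag (F : comNzRingType) n (d : 'rV[F]_n) p :
  diag_mx d ^+ p = diag_mx (\row_j d 0 j ^+ p).
Proof.
elim: p => [|p IH].
  rewrite expr0; apply/matrixP => i j; rewrite !mxE expr0.
  by [].
rewrite exprS IH -mulmxE mulmx_diag; congr diag_mx.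
by apply/rowP => j; rewrite !mxE exprS.
Qed.

(* The spectral theorem is available over numClosedFieldType only, hence the
   detour through R[i]. *)
Lemma mxtrace_exp_sym (R : rcfType) n (M : 'M[R]_n) (mu : seq R) p :
  M^T = M -> char_poly M = \prod_(x <- mu) ('X - x%:P) ->
  \tr (M ^+ p) = \sum_(x <- mu) x ^+ p.
Proof.
move=> Msym Mchar.
pose f : {rmorphism R -> R[i]} := real_complex R.
pose MC := map_mx f M.
have /orthomx_spectralP MCE : MC \is normalmx.
  apply: symmetric_normalmx.
    by apply/is_hermitianmxP; rewrite expr0 scale1r map_mx_id// /MC map_trmx Msym.
  by apply/mxOverP => i j; rewrite mxE; apply/complex_realP; exists (M i j).
have Pu := spectral_unit MC.
set P := spectralmx MC in MCE Pu; set d := spectral_diag MC in MCE.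
(* Both sequences list the roots of one split polynomial, the characteristic polynomial of [MC]. *)
have perm : perm_eq [seq f x | x <- mu] [seq d 0 i | i <- index_enum 'I_n].
  apply: prod_XsubC_eq; rewrite !big_map.
  transitivity (char_poly MC).
    rewrite -map_char_poly Mchar rmorph_prod; apply: eq_bigr => x _.
    by rewrite rmorphB /= map_polyX map_polyC.
  rewrite MCE char_poly_similar// char_poly_trig ?diag_mx_is_trig//.
  by apply: eq_bigr => i _; rewrite mxE eqxx.
apply: (fmorph_inj f); rewrite -trace_map_mx.
have -> : map_mx f (M ^+ p) = MC ^+ p by rewrite rmorphXn.
rewrite MCE expmx_similar// mxtrace_mulC mulmxA mulmxV// mul1mx expmx_diag.
rewrite mxtrace_diag rmorph_sum.
rewrite [RHS](eq_bigr (fun x => f x ^+ p)) => [|x _]; last by rewrite rmorphXn.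
rewrite -(big_map f xpredT (fun y => y ^+ p)) (perm_big _ perm) big_map.
by apply: eq_bigr => i _; rewrite mxE.
Qed.

(** * From bounds on traces of powers to bounds on quadratic forms *)

Lemma mxtrace_mul_tr (R : comNzRingType) m n (A : 'M[R]_(m, n)) :
  \tr (A *m A^T) = \sum_i \sum_j A i j ^+ 2.
Proof.
by apply: eq_bigr => i _; rewrite mxE; apply: eq_bigr => j _; rewrite !mxE expr2.
Qed.

Lemma mulmx_tr_cV (R : comNzRingType) n (x y : 'cV[R]_n) :
  (x^T *m y) 0 0 = \sum_i x i 0 * y i 0.
Proof. by rewrite mxE; apply: eq_bigr => i _; rewrite mxE. Qed.

Lemma mulmx_tr_cV_ge0 (R : realFieldType) n (x : 'cV[R]_n) :
  0 <= (x^T *m x) 0 0.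
Proof. by rewrite mulmx_tr_cV sumr_ge0// => i _; rewrite -expr2 sqr_ge0. Qed.

Lemma cauchy_schwarz_cV (R : realFieldType) n (x y : 'cV[R]_n) :
  (x^T *m y) 0 0 ^+ 2 <= (x^T *m x) 0 0 * (y^T *m y) 0 0.
Proof. by rewrite !mulmx_tr_cV; exact: cauchy_schwarz. Qed.

Lemma trmx_exp (R : comNzRingType) n (A : 'M[R]_n) p : (A ^+ p)^T = A^T ^+ p.
Proof.
elim: p => [|p IH]; first by rewrite !expr0 trmx1.
by rewrite exprS exprSr -!mulmxE trmx_mul IH.
Qed.

(** The trace is the squared Frobenius norm; Cauchy-Schwarz is applied to each row of [A]. *)
Lemma sqnorm_mulmx_le (R : realFieldType) n (A : 'M[R]_n) (v : 'cV[R]_n) :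
  ((A *m v)^T *m (A *m v)) 0 0 <= \tr (A *m A^T) * (v^T *m v) 0 0.
Proof.
rewrite mxtrace_mul_tr !mulmx_tr_cV mulr_suml; apply: ler_sum => i _.
rewrite -expr2 mxE; apply: (le_trans (cauchy_schwarz _ _ _)).
by rewrite ler_wpM2l ?sumr_ge0// => j _; exact: sqr_ge0.
Qed.

(* Repeated squaring: [q p := v^T E^(2^(p+1)) v] satisfies [q p ^ 2 <= |v|^2 q (p+1)],
   while [q p <= |v|^2 tr (E^(2^(p+1)))]; the constant [c] disappears after taking
   [2^p]-th roots. *)
Lemma sqnorm_mulmx_le_of_trace (R : archiRealFieldType) n (E : 'M[R]_n) (c eps : R)
    (v : 'cV[R]_n) : E^T = E -> 0 <= eps ->
  (forall p, (0 < p)%N -> \tr (E ^+ (2 * p)) <= c * eps ^+ (2 * p)) ->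
  ((E *m v)^T *m (E *m v)) 0 0 <= eps ^+ 2 * (v^T *m v) 0 0.
Proof.
move=> Esym eps0 Htr; set N := (v^T *m v) 0 0.
have N0 : 0 <= N by exact: mulmx_tr_cV_ge0.
have symX p : (E ^+ p)^T = E ^+ p by rewrite trmx_exp Esym.
pose q p := ((E ^+ (2 ^ p) *m v)^T *m (E ^+ (2 ^ p) *m v)) 0 0.
have qE p : q p = (v^T *m (E ^+ (2 ^ p.+1) *m v)) 0 0.
  by rewrite /q trmx_mul symX expnS mul2n -addnn exprD -mulmxE !mulmxA.
have q0 p : 0 <= q p by exact: mulmx_tr_cV_ge0.
have qS p : q p ^+ 2 <= N * q p.+1 by rewrite qE; exact: cauchy_schwarz_cV.
(* This is [(q 0 / N) ^+ (2 ^ p) <= q p / N] with denominators cleared. *)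
have q_iter p : q 0%N ^+ (2 ^ p) * N <= N ^+ (2 ^ p) * q p.
  elim: p => [|p IH]; first by rewrite expn0 !expr1 mulrC.
  have [N_eq0|N_neq0] := eqVneq N 0.
    by rewrite N_eq0 mulr0 mulr_ge0 ?exprn_ge0.
  have N_gt0 : 0 < N by rewrite lt0r N_neq0.
  rewrite -(ler_pM2r N_gt0) expnSr !exprM.
  apply: (@le_trans _ _ ((N ^+ (2 ^ p) * q p) ^+ 2)).
    rewrite -mulrA -expr2 -exprMn lerXn2r// nnegrE ?mulr_ge0 ?exprn_ge0//.
  by rewrite exprMn -[leRHS]mulrA [_ * N in leRHS]mulrC ler_wpM2l ?sqr_ge0.
have q_le p : q p <= c * eps ^+ (2 ^ p.+1) * N.
  apply: (le_trans (sqnorm_mulmx_le _ _)); rewrite ler_wpM2r// symX.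
  rewrite mulmxE -exprD addnn -mul2n expnS; apply: Htr; exact: expn_gt0.
have [N_eq0|N_neq0] := eqVneq N 0.
  by have := q_le 0%N; rewrite N_eq0 !mulr0 /q expn0 expr1.
have N_gt0 : 0 < N by rewrite lt0r N_neq0.
have -> : ((E *m v)^T *m (E *m v)) 0 0 = q 0%N by rewrite /q expn0 expr1.
apply: (@le_of_le_expr2 _ c); rewrite ?mulr_ge0 ?sqr_ge0//.
move=> p; rewrite -(ler_pM2r N_gt0); apply: (le_trans (q_iter p)).
rewrite exprMn -exprM -expnS.
have -> : c * (eps ^+ (2 ^ p.+1) * N ^+ (2 ^ p)) * N =
  N ^+ (2 ^ p) * (c * eps ^+ (2 ^ p.+1) * N) by ring.
by rewrite ler_wpM2l ?exprn_ge0.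
Qed.

Lemma form_le_of_trace (R : archiRealFieldType) n (E : 'M[R]_n) (c eps : R)
    (x y : 'cV[R]_n) : E^T = E -> 0 <= eps ->
  (forall p, (0 < p)%N -> \tr (E ^+ (2 * p)) <= c * eps ^+ (2 * p)) ->
  (x^T *m (E *m y)) 0 0 ^+ 2 <=
    eps ^+ 2 * ((x^T *m x) 0 0 * (y^T *m y) 0 0).
Proof.
move=> Esym eps0 Htr; apply: (le_trans (cauchy_schwarz_cV _ _)).
rewrite mulrCA ler_wpM2l ?mulmx_tr_cV_ge0//.
exact: sqnorm_mulmx_le_of_trace Htr.
Qed.

(** * Deflation by the leading eigenpairs *)

(** [M] acts as [L] on the columns of [B], so in the product of two deflated powers the three terms
    other than the power of [M] are the same matrix with signs -, -, +. At [p = 0] the right side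
    would be [1 - B *m B^T], hence the positivity of [p]. *)
Lemma expmx_deflation (R : comNzRingType) n m (M : 'M[R]_n) (B : 'M[R]_(n, m))
    (L : 'M[R]_m) p :
  M *m B = B *m L -> B^T *m M = L *m B^T -> B^T *m B = 1%:M -> (0 < p)%N ->
  (M - B *m L *m B^T) ^+ p = M ^+ p - B *m L ^+ p *m B^T.
Proof.
move=> MB BM BB.
have BMp q : B^T *m M ^+ q = L ^+ q *m B^T.
  elim: q => [|q IH]; first by rewrite !expr0 mulmx1 mul1mx.
  by rewrite exprSr -mulmxE mulmxA IH -mulmxA BM mulmxA mulmxE -exprSr.
case: p => // p _; elim: p => [|p IH]; first by rewrite !expr1.
have MpB : M *m (B *m L ^+ p.+1) = B *m L ^+ p.+2.
  by rewrite mulmxA MB -mulmxA mulmxE -exprS.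
rewrite exprS {}IH -mulmxE mulmxBl !mulmxBr mulmxE -exprS -mulmxE.
rewrite [M *m (_ *m B^T)]mulmxA MpB.
have -> : B *m L *m B^T *m M ^+ p.+1 = B *m L ^+ p.+2 *m B^T.
  by rewrite -[LHS]mulmxA BMp mulmxA -(mulmxA B) (exprS L p.+1) -mulmxE.
have -> : B *m L *m B^T *m (B *m L ^+ p.+1 *m B^T) = B *m L ^+ p.+2 *m B^T.
  rewrite -!mulmxA (mulmxA B^T) BB mul1mx; congr (_ *m _).
by rewrite subrr subr0.
Qed.

Lemma mxtrace_deflation_le (R : realType) n m (M : 'M[R]_n) (mu : n.-tuple R)
    (B : 'M[R]_(n, m)) (eps : R) p :
  let L := diag_mx (\row_(i < m) mu`_i) in
  M^T = M -> char_poly M = \prod_(x <- mu) ('X - x%:P) -> (m <= n)%N ->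
  M *m B = B *m L -> B^T *m B = 1%:M ->
  (forall i, (m <= i < n)%N -> `|mu`_i| <= eps) -> (0 < p)%N ->
  \tr ((M - B *m L *m B^T) ^+ (2 * p)) <= n%:R * eps ^+ (2 * p).
Proof.
move=> L Msym Mchar mn MB BB Heps p0.
have BM : B^T *m M = L *m B^T.
  by have := congr1 trmx MB; rewrite !trmx_mul tr_diag_mx Msym.
rewrite expmx_deflation ?muln_gt0// raddfB /= (mxtrace_exp_sym _ Msym Mchar).
rewrite -mulmxA mxtrace_mulC -mulmxA BB mulmx1 expmx_diag mxtrace_diag.
rewrite (big_nth 0) size_tuple big_mkord.
have -> : \sum_(i < m) (\row_j (\row_(i < m) mu`_i) 0 j ^+ (2 * p)) 0 i =
    \sum_(i < n | (i < m)%N) mu`_i ^+ (2 * p).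
  rewrite (big_ord_narrow_cond (P := predT) (F := fun i => mu`_i ^+ (2 * p)) mn).
  by apply: eq_bigr => i _; rewrite !mxE.
rewrite (bigID (fun i : 'I_n => (i < m)%N)) /= addrC addrK.
apply: (@le_trans _ _ (\sum_(i < n | ~~ (i < m)%N) eps ^+ (2 * p))).
  apply: ler_sum => i; rewrite -leqNgt => mi.
  have Hi : `|mu`_i| <= eps by apply: Heps; rewrite mi ltn_ord.
  have e0 : 0 <= eps by exact: le_trans Hi.
  rewrite !exprM -real_normK ?num_real// lerXn2r ?nnegrE ?sqr_ge0//.
  by rewrite lerXn2r ?nnegrE.
(* The [n - m] remaining terms are padded with [m] nonnegative ones to reach the factor [n]. *)
rewrite [leRHS]mulr_natl -[X in _ *+ X]card_ord -sumr_const.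
rewrite [leRHS](bigID (fun i : 'I_n => (i < m)%N)) /= lerDr.
by apply: sumr_ge0 => i _; rewrite exprM exprn_ge0// sqr_ge0.
Qed.

Lemma deflated_form_le (R : realType) n m (M : 'M[R]_n) (mu : n.-tuple R)
    (u : 'I_m -> 'cV[R]_n) (eps : R) (x y : 'cV[R]_n) :
  M^T = M -> char_poly M = \prod_(z <- mu) ('X - z%:P) -> (m < n)%N ->
  orthonormal_eigenvectors M mu u ->
  (forall i, (m <= i < n)%N -> `|mu`_i| <= eps) ->
  ((x^T *m (M *m y)) 0 0
     - \sum_(i < m) mu`_i * (((u i)^T *m x) 0 0 * ((u i)^T *m y) 0 0)) ^+ 2 <=
    eps ^+ 2 * ((x^T *m x) 0 0 * (y^T *m y) 0 0).
Proof.
move=> Msym Mchar mn [Meig orth] Heps.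
(* Index [m] exists because [m < n], and the bound there forces [eps] to be nonnegative. *)
have eps0 : 0 <= eps by apply: le_trans (Heps m _); rewrite ?leqnn.
pose B : 'M[R]_(n, m) := \matrix_(j, i) u i j 0.
pose L := diag_mx (\row_(i < m) mu`_i).
have MB : M *m B = B *m L.
  apply/matrixP => j i; rewrite mul_mx_diag mxE.
  have /colP/(_ j) := Meig i; rewrite !mxE mulrC => <-.
  by apply: eq_bigr => l _; rewrite mxE.
have BTE i (z : 'cV[R]_n) : (B^T *m z) i 0 = ((u i)^T *m z) 0 0.
  by rewrite !mxE; apply: eq_bigr => l _; rewrite !mxE.
have LE i (z : 'cV[R]_m) : (L *m z) i 0 = mu`_i * z i 0.
  by rewrite mul_diag_mx !mxE.
have BB : B^T *m B = 1%:M.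
  apply/matrixP => i j; have /matrixP/(_ 0 0) := orth i j.
  rewrite !mxE mulr1n => <-.
  by apply: eq_bigr => l _; rewrite !mxE.
have -> : \sum_(i < m) mu`_i * (((u i)^T *m x) 0 0 * ((u i)^T *m y) 0 0) =
    (x^T *m (B *m L *m B^T *m y)) 0 0.
  rewrite -!mulmxA mulmxA -[x^T *m B]trmxK trmx_mul trmxK mulmx_tr_cV.
  by apply: eq_bigr => i _; rewrite LE !BTE mulrCA.
have -> : (x^T *m (M *m y)) 0 0 - (x^T *m (B *m L *m B^T *m y)) 0 0 =
    (x^T *m ((M - B *m L *m B^T) *m y)) 0 0.
  rewrite mulmxBl mulmxBr; move: (x^T *m (M *m y)) => a.
  by move: (x^T *m _) => b; rewrite !mxE.
apply: (form_le_of_trace (c := n%:R)) => //.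
  by rewrite linearB /= Msym !trmx_mul trmxK tr_diag_mx mulmxA.
by move=> p; apply: mxtrace_deflation_le => //; exact: ltnW.
Qed.

(** * The arithmetic of the discrepancy estimate *)

(** The multipliers are absorbed into [a], whose squares can only shrink. *)
Lemma contraction_cauchy_schwarz (R : realFieldType) (I : finType)
    (mu a b : I -> R) : (forall i, `|mu i| <= 1) ->
  (\sum_i mu i * (a i * b i)) ^+ 2 <= (\sum_i a i ^+ 2) * (\sum_i b i ^+ 2).
Proof.
move=> mu1; rewrite (eq_bigr (fun i => mu i * a i * b i)); last first.
  by move=> i _; rewrite mulrA.
apply: (le_trans (cauchy_schwarz _ _ _)).
rewrite ler_wpM2r ?sumr_ge0// => [i _|]; first exact: sqr_ge0.
apply: ler_sum => i _; rewrite exprMn -[leRHS]mul1r ler_wpM2r ?sqr_ge0//.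
by rewrite -real_normK ?num_real// expr_le1.
Qed.

Lemma ler_abs_of_sqr (R : realDomainType) (t v : R) :
  0 <= v -> t ^+ 2 <= v ^+ 2 -> `|t| <= v.
Proof.
move=> v0; rewrite -[t ^+ 2]real_normK ?num_real//.
by rewrite ler_pXn2r ?nnegrE.
Qed.

(** Here [x], [y], [vA], [vB] stand for volumes of subsets and clusters, [ca], [cb] for centers,
    [da], [db] for deviations of the subsets, [e1], [e2] for values of the deflated form. [wAB]
    carries no deviation, since a whole cluster has none. *)
Lemma low_rank_discrepancy (R : rcfType) (I : finType)
    (mu ca cb da db : I -> R) (vA vB x y k s eps e1 e2 wXY wAB : R) :
  (forall i, `|mu i| <= 1) -> 0 < vA -> 0 < vB ->
  0 <= x <= vA -> 0 <= y <= vB -> 0 <= s -> s ^+ 2 <= k -> 0 <= eps ->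
  vA * (\sum_i ca i ^+ 2) <= k -> vB * (\sum_i cb i ^+ 2) <= k ->
  \sum_i da i ^+ 2 <= vA * s ^+ 2 -> \sum_i db i ^+ 2 <= vB * s ^+ 2 ->
  e1 ^+ 2 <= eps ^+ 2 * (vA * vB) -> e2 ^+ 2 <= eps ^+ 2 * (vA * vB) ->
  wXY = x * y + \sum_i mu i * ((x * ca i + da i) * (y * cb i + db i)) + e1 ->
  wAB = vA * vB + \sum_i mu i * (vA * ca i * (vB * cb i)) + e2 ->
  `|wXY - wAB / (vA * vB) * x * y| <=
    3 * (Num.sqrt (2 * k) * s + eps) * Num.sqrt (vA * vB).
Proof.
move=> mu1 A0 B0 /andP[x0 xA] /andP[y0 yB] s0 sk eps0 caK cbK daK dbK e1K e2K
  wXYE wABE.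
have vAB0 : 0 < vA * vB by rewrite mulr_gt0.
have sq0 (f : I -> R) : 0 <= \sum_i f i ^+ 2.
  by apply: sumr_ge0 => i _; exact: sqr_ge0.
have k0 : 0 <= k by apply: le_trans sk; exact: sqr_ge0.
set S := Num.sqrt (vA * vB).
have S2 : S ^+ 2 = vA * vB by rewrite sqr_sqrtr// ltW.
have S0 : 0 <= S by exact: sqrtr_ge0.
set g := Num.sqrt (2 * k) * s * S.
have g0 : 0 <= g by rewrite !mulr_ge0// sqrtr_ge0.
have g2 : g ^+ 2 = 2 * k * s ^+ 2 * (vA * vB).
  by rewrite !exprMn S2 sqr_sqrtr// mulr_ge0.
(* Each cross term is bounded by the square root of the left side; the 2 inside [g] is slack. *)
have g2_ge : k * s ^+ 2 * (vA * vB) <= g ^+ 2.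
  have k2 : k <= 2 * k by lra.
  by rewrite g2 !ler_wpM2r ?sqr_ge0// ltW.
pose t1 := \sum_i mu i * (ca i * db i).
pose t2 := \sum_i mu i * (da i * cb i).
pose t3 := \sum_i mu i * (da i * db i).
pose t4 := \sum_i mu i * (ca i * cb i).
(* Of the two factors [vA] bounding [x ^+ 2], one turns the squared center into [k] and the other
   stays in the bound. *)
have t1K : `|x * t1| <= g.
  apply: ler_abs_of_sqr => //; apply: le_trans g2_ge.
  rewrite exprMn.
  apply: (@le_trans _ _ (vA ^+ 2 * ((\sum_i ca i ^+ 2) * (vB * s ^+ 2)))).
    rewrite ler_pM ?sqr_ge0 ?lerXn2r ?nnegrE ?(ltW A0)//.
    apply: (le_trans (contraction_cauchy_schwarz _ _ mu1)).
    by rewrite ler_wpM2l.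
  have -> : vA ^+ 2 * ((\sum_i ca i ^+ 2) * (vB * s ^+ 2)) =
    vA * (\sum_i ca i ^+ 2) * (s ^+ 2 * (vA * vB)) by ring.
  by rewrite -(mulrA k) ler_wpM2r// mulr_ge0 ?sqr_ge0 ?ltW.
have t2K : `|y * t2| <= g.
  apply: ler_abs_of_sqr => //; apply: le_trans g2_ge.
  rewrite exprMn.
  apply: (@le_trans _ _ (vB ^+ 2 * (vA * s ^+ 2 * (\sum_i cb i ^+ 2)))).
    rewrite ler_pM ?sqr_ge0 ?lerXn2r ?nnegrE ?(ltW B0)//.
    apply: (le_trans (contraction_cauchy_schwarz _ _ mu1)).
    by rewrite ler_wpM2r.
  have -> : vB ^+ 2 * (vA * s ^+ 2 * (\sum_i cb i ^+ 2)) =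
    vB * (\sum_i cb i ^+ 2) * (s ^+ 2 * (vA * vB)) by ring.
  by rewrite -(mulrA k) ler_wpM2r// mulr_ge0 ?sqr_ge0 ?ltW.
(* Two deviations give [s ^+ 2] twice; one of them is traded for [k]. *)
have t3K : `|t3| <= g.
  apply: ler_abs_of_sqr => //; apply: le_trans g2_ge.
  apply: (le_trans (contraction_cauchy_schwarz _ _ mu1)).
  apply: (@le_trans _ _ (vA * s ^+ 2 * (vB * s ^+ 2))).
    by rewrite ler_pM.
  have -> : vA * s ^+ 2 * (vB * s ^+ 2) = s ^+ 2 * (s ^+ 2 * (vA * vB)) by ring.
  by rewrite -(mulrA k) ler_wpM2r// mulr_ge0 ?sqr_ge0 ?ltW.
have e1S : `|e1| <= eps * S.
  by apply: ler_abs_of_sqr; rewrite ?mulr_ge0// exprMn S2.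
have e2S : `|e2| <= eps * S.
  by apply: ler_abs_of_sqr; rewrite ?mulr_ge0// exprMn S2.
(* The density of the clusters rescales [e2] by [r], which is at most 1. *)
pose r := x * y / (vA * vB).
have r0 : 0 <= r by apply: divr_ge0; [exact: mulr_ge0 | exact: ltW].
have r1 : r <= 1 by rewrite /r ler_pdivrMr// mul1r ler_pM.
have e2r : `|e2 * r| <= eps * S.
  rewrite normrM (ger0_norm r0); apply: le_trans e2S.
  by rewrite -[leRHS]mulr1 ler_wpM2l.
(* The main terms [x * y * (1 + t4)] of both sides cancel. *)
have -> : wXY - wAB / (vA * vB) * x * y = x * t1 + y * t2 + t3 + e1 - e2 * r.
  have -> : wXY = x * y + (x * y * t4 + x * t1 + y * t2 + t3) + e1.
    rewrite wXYE; congr (_ + _ + _).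
    rewrite !mulr_sumr -!big_split /=; apply: eq_bigr => i _; ring.
  have -> : wAB = vA * vB + vA * vB * t4 + e2.
    rewrite wABE mulr_sumr; congr (_ + _ + _).
    by apply: eq_bigr => i _; ring.
  rewrite /r; field.
  by rewrite !gt_eqF.
have -> : 3 * (Num.sqrt (2 * k) * s + eps) * S = 3 * g + 3 * (eps * S).
  by rewrite /g; ring.
have eS0 : 0 <= eps * S by rewrite mulr_ge0.
move: t1K t2K t3K e1S e2r; rewrite !ler_norml.
move=> /andP[? ?] /andP[? ?] /andP[? ?] /andP[? ?] /andP[? ?].
by apply/andP; split; lra.
Qed.

(** * Volumes, centers and weighted variances *)

Lemma Vol_ge0 (R : realType) n (W : 'M[R]_n) (U : {set 'I_n}) :
  (forall i, 0 < deg W i) -> 0 <= Vol W U.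
Proof. by move=> d0; apply: sumr_ge0 => i _; exact: ltW. Qed.

Lemma Vol_gt0 (R : realType) n (W : 'M[R]_n) (U : {set 'I_n}) :
  (forall i, 0 < deg W i) -> U != set0 -> 0 < Vol W U.
Proof.
move=> d0 /set0Pn[i iU]; rewrite /Vol (bigD1 i)//= ltr_pwDl// sumr_ge0// => j _.
exact: ltW.
Qed.

Lemma Vol_subset (R : realType) n (W : 'M[R]_n) (X U : {set 'I_n}) :
  (forall i, 0 < deg W i) -> X \subset U -> Vol W X <= Vol W U.
Proof.
move=> d0 XU; rewrite /Vol [leRHS](big_setID X) /= (setIidPr XU) lerDl.
by apply: sumr_ge0 => i _; exact: ltW.
Qed.

Lemma Vol_center (R : realType) n p (W : 'M[R]_n) (X : 'M[R]_(n, p))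
    (U : {set 'I_n}) i : Vol W U != 0 ->
  Vol W U * center W X U 0 i = \sum_(j in U) deg W j * X j i.
Proof.
move=> U0; rewrite mxE mulrA mulfV// mul1r summxE.
by apply: eq_bigr => j _; rewrite !mxE.
Qed.

(** The parallel axis (Steiner) identity, proved one coordinate at a time. *)
Lemma sum_sqnorm_center (R : realType) n p (W : 'M[R]_n) (X : 'M[R]_(n, p))
    (U : {set 'I_n}) : Vol W U != 0 ->
  \sum_(j in U) deg W j * sqnorm (row j X) =
    \sum_(j in U) deg W j * sqnorm (row j X - center W X U)
      + Vol W U * sqnorm (center W X U).
Proof.
move=> U0; rewrite /sqnorm.
under eq_bigr do rewrite mulr_sumr.
under [X in _ = X + _]eq_bigr do rewrite mulr_sumr.
rewrite exchange_big /= [X in _ = X + _]exchange_big /= mulr_sumr -big_split /=.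
apply: eq_bigr => i _; set c := center W X U.
have -> : \sum_(j in U) deg W j * (row j X - c) 0 i ^+ 2 =
    \sum_(j in U) deg W j * (row j X) 0 i ^+ 2
     - 2 * c 0 i * \sum_(j in U) deg W j * X j i + c 0 i ^+ 2 * Vol W U.
  rewrite /Vol !mulr_sumr -sumrN -!big_split /=; apply: eq_bigr => j _.
  by rewrite !mxE; ring.
by rewrite -Vol_center// -/c; ring.
Qed.

Lemma sqnorm_ge0 (R : realType) m (r : 'rV[R]_m) : 0 <= sqnorm r.
Proof. by apply: sumr_ge0 => i _; exact: sqr_ge0. Qed.

(** Cauchy-Schwarz with each weight split as a product of two square roots gives the bound with [Z]
    in place of [U]; both factors grow when [Z] is enlarged. *)
Lemma sum_deviation_sqr_le (R : realType) n p (W : 'M[R]_n) (X : 'M[R]_(n, p))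
    (Z U : {set 'I_n}) (c : 'rV[R]_p) :
  (forall i, 0 < deg W i) -> Z \subset U ->
  \sum_i (\sum_(j in Z) deg W j * (X j i - c 0 i)) ^+ 2 <=
    Vol W U * \sum_(j in U) deg W j * sqnorm (row j X - c).
Proof.
move=> d0 ZU; have sd j : Num.sqrt (deg W j) ^+ 2 = deg W j.
  by rewrite sqr_sqrtr// ltW.
apply: (@le_trans _ _
  (Vol W Z * \sum_(j in Z) deg W j * sqnorm (row j X - c))).
  rewrite (eq_bigr (fun j => \sum_i deg W j * (X j i - c 0 i) ^+ 2)); last first.
    by move=> j _; rewrite mulr_sumr; apply: eq_bigr => i _; rewrite !mxE.
  rewrite exchange_big /= mulr_sumr; apply: ler_sum => i _.
  rewrite (eq_bigr (fun j => Num.sqrt (deg W j)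
    * (Num.sqrt (deg W j) * (X j i - c 0 i)))); last first.
    by move=> j _; rewrite mulrA -expr2 sd.
  apply: (le_trans (cauchy_schwarz _ _ _)).
  under [X in X * _ <= _]eq_bigr do rewrite sd.
  by under [X in _ * X <= _]eq_bigr do rewrite exprMn sd.
have term0 j : 0 <= deg W j * sqnorm (row j X - c).
  by rewrite mulr_ge0 ?sqnorm_ge0// ltW.
apply: ler_pM; rewrite ?Vol_ge0 ?Vol_subset ?sumr_ge0//.
rewrite [leRHS](big_setID Z) /= (setIidPr ZU) lerDl.
by apply: sumr_ge0.
Qed.

Lemma sum_kpartition (R : realType) n k (V : 'I_k -> {set 'I_n})
    (F : 'I_n -> R) : kpartition V ->
  \sum_a \sum_(j in V a) F j = \sum_j F j.
Proof.
move=> [_ Vdisj Vcov]; rewrite -partition_disjoint_bigcup//.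
by apply: eq_bigl => i; have [a ia] := Vcov i; apply/bigcupP; exists a.
Qed.

(** * Cuts and representatives expressed through the modularity matrix *)

(* The vector D^(1/2) 1_X. *)
Definition hvec (R : realType) n (W : 'M[R]_n) (X : {set 'I_n}) : 'cV[R]_n :=
  \col_j (if j \in X then Num.sqrt (deg W j) else 0).

Lemma hvec_sum (R : realType) n (W : 'M[R]_n) (X : {set 'I_n}) (F : 'I_n -> R) :
  \sum_j hvec W X j 0 * F j = \sum_(j in X) Num.sqrt (deg W j) * F j.
Proof.
rewrite [RHS]big_mkcond; apply: eq_bigr => j _.
by rewrite mxE; case: ifP => _//; rewrite mul0r.
Qed.

Lemma hvec_sqr (R : realType) n (W : 'M[R]_n) (X : {set 'I_n}) :
  (forall i, 0 < deg W i) -> ((hvec W X)^T *m hvec W X) 0 0 = Vol W X.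
Proof.
move=> d0; rewrite mulmx_tr_cV hvec_sum; apply: eq_bigr => j jX.
by rewrite mxE jX -expr2 sqr_sqrtr// ltW.
Qed.

Lemma representativesE (R : realType) n m (W : 'M[R]_n)
    (u : 'I_m -> 'cV[R]_n) j i :
  representatives W u j i = (Num.sqrt (deg W j))^-1 * u i j 0.
Proof. by rewrite mxE mul_diag_mx !mxE. Qed.

(** This links the spectral expansion to the clustered points: [deg W j] times the inverse root in
    the representative leaves the root in [hvec]. *)
Lemma hvec_representatives (R : realType) n m (W : 'M[R]_n)
    (u : 'I_m -> 'cV[R]_n) (X : {set 'I_n}) i : (forall i, 0 < deg W i) ->
  ((u i)^T *m hvec W X) 0 0 = \sum_(j in X) deg W j * representatives W u j i.
Proof.
move=> d0; rewrite mulmx_tr_cV; under eq_bigr do rewrite mulrC.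
rewrite hvec_sum; apply: eq_bigr => j _; rewrite representativesE.
rewrite -{2}[deg W j]sqr_sqrtr ?(ltW (d0 j))// expr2 -mulrA mulVKf//.
by rewrite gt_eqF// sqrtr_gt0.
Qed.

Lemma modularity_mxE (R : realType) n (W : 'M[R]_n) i j :
  modularity_mx W i j = (Num.sqrt (deg W i))^-1 * W i j * (Num.sqrt (deg W j))^-1
    - Num.sqrt (deg W i) * Num.sqrt (deg W j).
Proof.
rewrite /modularity_mx /Dinvsqrt mxE mul_mx_diag mul_diag_mx !mxE.
by rewrite big_ord1 !mxE.
Qed.

Lemma modularity_mx_sym (R : realType) n (W : 'M[R]_n) :
  W^T = W -> (modularity_mx W)^T = modularity_mx W.
Proof.
move=> Wsym; apply/matrixP => i j; rewrite mxE !modularity_mxE.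
have /matrixP/(_ i j) := Wsym; rewrite mxE => ->.
by ring.
Qed.

(** The roots in [hvec] undo the normalization of [W], and the rank-one part of the modularity
    matrix yields the product of volumes. *)
Lemma hvec_modularity (R : realType) n (W : 'M[R]_n) (X Y : {set 'I_n}) :
  (forall i, 0 < deg W i) ->
  ((hvec W X)^T *m (modularity_mx W *m hvec W Y)) 0 0 =
    wcut W X Y - Vol W X * Vol W Y.
Proof.
move=> d0; rewrite mulmx_tr_cV hvec_sum /wcut /Vol mulr_suml -sumrB.
apply: eq_bigr => i _.
have s0 j : Num.sqrt (deg W j) != 0 by rewrite gt_eqF// sqrtr_gt0.
have sd j : deg W j = Num.sqrt (deg W j) ^+ 2 by rewrite sqr_sqrtr// ltW.
rewrite mxE; under eq_bigr do rewrite mulrC.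
rewrite hvec_sum !mulr_sumr -sumrB; apply: eq_bigr => j _.
rewrite modularity_mxE [deg W i in RHS]sd [deg W j in RHS]sd.
by field; rewrite !s0.
Qed.

(** The weights cancel the inverse degrees, leaving the squared norms of [m] unit vectors. *)
Lemma sum_sqnorm_representatives (R : realType) n m (W : 'M[R]_n)
    (u : 'I_m -> 'cV[R]_n) : (forall i, 0 < deg W i) ->
  (forall i j, (u i)^T *m u j = (i == j)%:R%:M) ->
  \sum_j deg W j * sqnorm (row j (representatives W u)) = m%:R.
Proof.
move=> d0 orth; rewrite /sqnorm; under eq_bigr do rewrite mulr_sumr.
rewrite exchange_big /= -[m in RHS]card_ord -sumr_const; apply: eq_bigr => i _.
have /matrixP/(_ 0 0) := orth i i.
rewrite mulmx_tr_cV mxE !eqxx => H; rewrite -[RHS]H; apply: eq_bigr => j _.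
rewrite mxE representativesE exprMn -{1}[deg W j]sqr_sqrtr ?(ltW (d0 j))//.
by rewrite exprVn mulrA mulfV ?mul1r ?expr2// sqrf_eq0 gt_eqF// sqrtr_gt0.
Qed.

(** * Discrepancy between and inside clusters *)

Lemma kcost_ge_cluster (R : realType) n p k (W : 'M[R]_n) (X : 'M[R]_(n, p))
    (V : 'I_k -> {set 'I_n}) a : (forall i, 0 < deg W i) ->
  \sum_(j in V a) deg W j * sqnorm (row j X - center W X (V a)) <= kcost W X V.
Proof.
move=> d0; rewrite /kcost (bigD1 a)//= lerDl; apply: sumr_ge0 => b _.
by apply: sumr_ge0 => j _; rewrite mulr_ge0 ?sqnorm_ge0// ltW.
Qed.

(** The case [a = b] is included, so one estimate serves both conclusions of the theorem. *)
Lemma cluster_discrepancy (R : realType) k n (W : 'M[R]_n) (mu : n.-tuple R)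
    (eps : R) (u : 'I_k.-1 -> 'cV[R]_n) (V : 'I_k -> {set 'I_n}) :
  (2 <= k)%N -> (k < n)%N -> W^T = W -> (forall i, 0 < deg W i) ->
  abs_sorted_spectrum (modularity_mx W) mu ->
  `|mu`_0| <= 1 -> `|mu`_k.-1| <= eps ->
  orthonormal_eigenvectors (modularity_mx W) mu u -> kpartition V ->
  let s := Num.sqrt (kcost W (representatives W u) V) in
  forall a b (X Y : {set 'I_n}), X \subset V a -> Y \subset V b ->
    `|wcut W X Y - rho W (V a) (V b) * Vol W X * Vol W Y| <=
      3 * (Num.sqrt (2 * k%:R) * s + eps) * Num.sqrt (Vol W (V a) * Vol W (V b)).
Proof.
move=> k2 kn Wsym d0 [Mchar Msort] mu0 muk ueig Vpart s a b X Y XA YB.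
set r := representatives W u in s *.
have mn : (k.-1 < n)%N by rewrite (leq_ltn_trans _ kn)// leq_pred.
have eps0 : 0 <= eps by exact: le_trans muk.
(* Indices start at 0: [mu]_k.-1[is the first eigenvalue left after deflation, so its
   bound]eps[passes to all later ones, as the bound 1 passes from]mu[_0]. *)
have mu_anti i j : (i <= j)%N -> (j < n)%N -> `|mu`_j| <= `|mu`_i|.
  move=> ij jn; apply: (sorted_leq_nth _ _ _ Msort); rewrite ?inE ?size_tuple//.
  - by move=> y x z yx zy; exact: le_trans yx.
  - exact: leq_ltn_trans ij jn.
have Va_gt0 c : 0 < Vol W (V c) by apply: Vol_gt0 => //; case: Vpart => + _ _; exact.
have Va_neq0 c : Vol W (V c) != 0 by rewrite gt_eqF.
have term0 (c : 'rV_(k.-1)) j : 0 <= deg W j * sqnorm (row j r - c).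
  by rewrite mulr_ge0 ?sqnorm_ge0// ltW.
have cost0 : 0 <= kcost W r V by do 2 apply: sumr_ge0 => ? _.
have s2 : s ^+ 2 = kcost W r V by rewrite sqr_sqrtr.
(* By the Steiner identity this total splits into the cost and the center terms, which bounds both
   by [k]. *)
have tot : \sum_c \sum_(j in V c) deg W j * sqnorm (row j r) = k.-1%:R.
  by rewrite sum_kpartition// sum_sqnorm_representatives//; case: ueig.
have k1k : k.-1%:R <= k%:R :> R by rewrite ler_nat leq_pred.
have s2k : s ^+ 2 <= k%:R.
  rewrite s2 (le_trans _ k1k)// -tot; apply: ler_sum => c _.
  rewrite sum_sqnorm_center// lerDl mulr_ge0 ?sqnorm_ge0//; exact: ltW.
have ctrK c : Vol W (V c) * sqnorm (center W r (V c)) <= k%:R.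
  rewrite (le_trans _ k1k)// -tot (bigD1 c)//= sum_sqnorm_center//.
  rewrite addrAC lerDr addr_ge0//; first by apply: sumr_ge0.
  apply: sumr_ge0 => e _; apply: sumr_ge0 => j _.
  by rewrite mulr_ge0 ?sqnorm_ge0// ltW.
pose del c (Z : {set 'I_n}) i :=
  \sum_(j in Z) deg W j * (r j i - center W r (V c) 0 i).
have delK c (Z : {set 'I_n}) : Z \subset V c -> \sum_i del c Z i ^+ 2 <= Vol W (V c) * s ^+ 2.
  move=> ZV; apply: (le_trans (sum_deviation_sqr_le _ _ d0 ZV)).
  by rewrite ler_wpM2l ?s2 ?kcost_ge_cluster// ltW.
have fE c (Z : {set 'I_n}) i : \sum_(j in Z) deg W j * r j i =
    Vol W Z * center W r (V c) 0 i + del c Z i.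
  rewrite mulr_suml -big_split; apply: eq_bigr => j _ /=; ring.
pose err (P Q : {set 'I_n}) := wcut W P Q - Vol W P * Vol W Q
  - \sum_(i < k.-1) mu`_i * ((\sum_(j in P) deg W j * r j i)
                             * (\sum_(j in Q) deg W j * r j i)).
(* [err P Q] is the deflated form at [hvec W P] and [hvec W Q], whose squared norms are the volumes
   of [P] and [Q]. *)
have errK (P Q : {set 'I_n}) : P \subset V a -> Q \subset V b ->
    err P Q ^+ 2 <= eps ^+ 2 * (Vol W (V a) * Vol W (V b)).
  move=> PA QB; apply: (@le_trans _ _ (eps ^+ 2 * (Vol W P * Vol W Q))).
    rewrite /err -hvec_modularity// -!hvec_sqr//.
    under eq_bigr do rewrite -!hvec_representatives//.
    apply: deflated_form_le Mchar mn ueig _; first exact: modularity_mx_sym.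
    move=> i /andP[ki iltn]; apply: le_trans muk; exact: mu_anti.
  by rewrite ler_wpM2l ?sqr_ge0// ler_pM ?Vol_ge0 ?Vol_subset.
apply: (@low_rank_discrepancy _ _ (fun i : 'I_k.-1 => mu`_i)
  (center W r (V a) 0) (center W r (V b) 0) (del a X) (del b Y)
  _ _ _ _ k%:R s eps (err X Y) (err (V a) (V b))).
- move=> i; apply: le_trans mu0; apply: mu_anti => //.
  exact: ltn_trans (ltn_ord i) mn.
- exact: Va_gt0.
- exact: Va_gt0.
- by rewrite Vol_ge0// Vol_subset.
- by rewrite Vol_ge0// Vol_subset.
- exact: sqrtr_ge0.
- exact: s2k.
- exact: eps0.
- exact: ctrK.
- exact: ctrK.
- exact: delK.
- exact: delK.
- exact: errK.
- exact: errK.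
- under eq_bigr do rewrite -!fE.
  by rewrite /err; ring.
(* On whole clusters the weighted sums equal volume times center, with zero deviation. *)
- under eq_bigr do rewrite !Vol_center//.
  by rewrite /err; ring.
Qed.

Theorem theorem3 (R : realType) (K c1 c2 : R)
    (hK : 0 < K) (hc1 : 0 < c1) (hc2 : 0 < c2) :
  exists C : R, 0 < C /\
    forall (k n : nat) (W : 'M[R]_n) (mu : n.-tuple R) (eps : R)
           (u : 'I_k.-1 -> 'cV[R]_n) (V : 'I_k -> {set 'I_n}),
      (2 <= k)%N -> (k < n)%N -> K <= k%:R^-1 ->
      weighted_graph W -> connected_graph W -> Vol W [set: 'I_n] = 1 ->
      (forall i, c1 / n%:R <= deg W i <= c2 / n%:R) ->
      abs_sorted_spectrum (modularity_mx W) mu ->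
      `|mu`_0| <= 1 -> eps < `|mu`_k.-2| -> `|mu`_k.-1| <= eps ->
      `|mu`_n.-1| = 0 ->
      orthonormal_eigenvectors (modularity_mx W) mu u ->
      min_kpartition W (representatives W u) V ->
      (forall a, K * n%:R <= #|V a|%:R) ->
      let s := Num.sqrt (kvariance k W (representatives W u)) in
      let alpha := C * (Num.sqrt (2 * k%:R) * s + eps) in
      (forall a b, a != b -> volume_regular W alpha (V a) (V b)) /\
      (forall a (X Y : {set 'I_n}), X \subset V a -> Y \subset V a ->
         `|wcut W X Y - rho W (V a) (V a) * Vol W X * Vol W Y|
           <= alpha * Vol W (V a)).
Proof.
exists 3; split=> // k n W mu eps u V k2 kn _ [Wsym _ _] _ _ degW Mspec mu0 _.
(* Minimality of [V] replaces the variance in [s] by the cost of [V]. *)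
move=> muk _ ueig [Vpart <-] _ s alpha.
have d0 i : 0 < deg W i.
  have /andP[d_ge _] := degW i; apply: lt_le_trans d_ge.
  by rewrite divr_gt0// ltr0n (leq_trans _ kn).
have main := cluster_discrepancy k2 kn Wsym d0 Mspec mu0 muk ueig Vpart.
split=> [a b ab|a X Y XA YA].
  by split=> [|X Y XA YB]; [case: Vpart => _ + _; exact | exact: main].
have := main a a X Y XA YA.
by rewrite -expr2 sqrtr_sqr (ger0_norm (Vol_ge0 _ d0)).
Qed.
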